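(* Let $a$ be a rational number with $v_3(a)=0$, and let $\mathcal{R}_a=\{(0,1/2),(0,-1/2),(a,1/2),(a,-1/2)\}$. Suppose $(x,z/2)\in\mathbb{R}^2$ has rational Euclidean distance to each of the four points of $\mathcal{R}_a$ (so $x,z\in\mathbb{Q}$). Then $v_3(x)<0$ or $v_3(z)<0$, and moreover $v_3(x)\neq v_3(z)$.
   Context: For a prime $p$ and a nonzero rational $t=p^k r/s$ with $r,s$ integers coprime to $p$, $v_p(t)=k$; and $v_p(0)=\infty$. *)

(* Defs.v *)
From HB Require Import structures.
From mathcomp Require Import all_boot all_order all_algebra.
From mathcomp Require Import mathcomp_extra boolp classical_sets reals.
From mathcomp Require Import constructive_ereal.

Set Implicit Arguments.
Unset Strict Implicit.
Unset Printing Implicit Defensive.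

Import Order.TTheory GRing.Theory Num.Theory.

Local Open Scope ring_scope.

(* The values lie in [\bar int], the integers extended by infinities; [-oo]   *)
(* is never taken. Meaningful for [p] prime; see [padic_valE].                *)
Definition padic_val (p : nat) (t : rat) : \bar int :=
  if t == 0 then +oo%E
  else ((logn p `|numq t|)%:Z - (logn p `|denq t|)%:Z)%:E%E.

Lemma padic_val_div (p : nat) (n d : int) : prime p -> n != 0 -> d != 0 ->
  padic_val p (n%:~R / d%:~R) = ((logn p `|n|)%:Z - (logn p `|d|)%:Z)%:E%E.
Proof.
move=> pp n0 d0; set t : rat := _ / _.
have t0 : t != 0 by rewrite mulf_neq0 ?invr_eq0 ?intr_eq0.
have eqt : numq t * d = n * denq t.
  apply/eqP; rewrite -(eqr_int rat) !rmorphM/= -eqr_div ?intr_eq0 ?denq_neq0//.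
  by rewrite divq_num_den.
have /(congr1 (logn p)) : (`|numq t| * `|d| = `|n| * `|denq t|)%N.
  by rewrite -!abszM eqt.
rewrite !lognM ?absz_gt0 ?numq_eq0 ?denq_neq0// => /(congr1 Posz).
rewrite !PoszD /padic_val (negbTE t0) => e; congr (_%:E)%E.
by apply/eqP; rewrite subr_eq addrAC eq_sym subr_eq e.
Qed.

Lemma padic_valE (p : nat) (k r s : int) : prime p ->
  coprimez p r -> coprimez p s ->
  padic_val p (p%:R ^ k * (r%:~R / s%:~R)) = k%:E%E.
Proof.
move=> pp cr cs.
have nz (u : int) : coprimez p u -> u != 0.
  by apply: contraTneq => ->; rewrite /coprimez gcdz0; case: p pp {cr cs} => [|[]].
have lu (u : int) : coprimez p u -> logn p `|u| = 0%N.
  by move=> cu; apply: logn_coprime; rewrite coprimezE in cu.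
have pX n : (p ^ n)%:Z != 0 by rewrite eqz_nat expn_eq0; case: p pp {cr cs nz lu}.
have [r0 s0] := (nz r cr, nz s cs).
case: k => n.
  have -> : (p%:R : rat) ^ n%:Z * (r%:~R / s%:~R)
      = ((p ^ n)%:Z * r)%:~R / s%:~R.
    by rewrite mulrA rmorphM /= -[(p ^ n)%:Z%:~R]/((p ^ n)%:R) natrX.
  rewrite padic_val_div// ?mulf_neq0//.
  by rewrite abszM lognM ?absz_gt0// (lu r)// (lu s)// addn0 subr0 pfactorK.
have -> : (p%:R : rat) ^ Negz n * (r%:~R / s%:~R)
    = r%:~R / ((p ^ n.+1)%:Z * s)%:~R.
  rewrite rmorphM /= -[(p ^ n.+1)%:Z%:~R]/((p ^ n.+1)%:R) natrX invfM.
  by rewrite mulrCA.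
rewrite padic_val_div// ?mulf_neq0//.
by rewrite abszM lognM ?absz_gt0// (lu r)// (lu s)// addn0 sub0r pfactorK.
Qed.

(* The norm of the library on [R * R] is the sup norm, hence the explicit     *)
(* formula.                                                                   *)
Definition eucl_dist (R : realType) (P Q : R * R) : R :=
  Num.sqrt ((P.1 - Q.1) ^+ 2 + (P.2 - Q.2) ^+ 2).

Definition rect_points (R : realType) (a : rat) : set (R * R) :=
  [set P | [\/ P = (0, 1 / 2), P = (0, - (1 / 2)),
               P = (ratr a, 1 / 2) | P = (ratr a, - (1 / 2))]].

(* Main.v *)
(** Over the residue field of order 3 a sum of two nonzero squares is [1 + 1],
which is not a square; hence two nonzero rationals of equal 3-adic valuation
never have a rational square as the sum of their squares.  Doubling the
distances from [(x, z / 2)] makes the sums [(2 x)^2 + (z -+ 1)^2] and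
[(2 x - 2 a)^2 + (z -+ 1)^2] rational squares.  If [x] and [z] were 3-integral,
then one of [z - 1], [z + 1] and one of [2 x], [2 x - 2 a] would be a 3-adic
unit, because the differences [2] and [2 a] are, and their squares would sum to
a square.  If the valuations of [x] and [z] are equal and negative, then [2 x]
and [z - 1] have equal valuation. *)
Require Import Defs.
From mathcomp Require Import all_boot all_order all_algebra.
From mathcomp Require Import mathcomp_extra boolp classical_sets reals.
From mathcomp Require Import constructive_ereal.
From mathcomp Require Import zify ring.

Import Order.TTheory GRing.Theory Num.Theory.

Local Open Scope ring_scope.

Lemma padic_val0 (p : nat) : padic_val p 0 = +oo%E.
Proof. by rewrite /padic_val eqxx. Qed.

Lemma padic_valN (p : nat) (t : rat) : padic_val p (- t) = padic_val p t.
Proof. by rewrite /padic_val oppr_eq0 numqN denqN abszN. Qed.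

Lemma padic_valM (p : nat) (s t : rat) : prime p ->
  padic_val p (s * t) = (padic_val p s + padic_val p t)%E.
Proof.
move=> pp; have [->|s0] := eqVneq s 0.
  by rewrite mul0r padic_val0 /padic_val; case: ifP.
have [->|t0] := eqVneq t 0.
  by rewrite mulr0 padic_val0 /padic_val; case: ifP.
rewrite -{1}[s]divq_num_den -{1}[t]divq_num_den mulf_div -!intrM.
rewrite padic_val_div ?mulf_neq0 ?numq_eq0 ?denq_neq0//.
rewrite !abszM !lognM ?absz_gt0 ?numq_eq0 ?denq_neq0//.
rewrite /padic_val (negbTE s0) (negbTE t0) -EFinD !PoszD; congr (_%:E)%E; ring.
Qed.

(** Over the common denominator [d], this says that a power of [p] dividing both [m] and [n] divides
    [m + n]. *)
Lemma padic_valD_ge (p : nat) (s t : rat) : prime p ->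
  (Order.min (padic_val p s) (padic_val p t) <= padic_val p (s + t)%R)%E.
Proof.
move=> pp; have [->|s0] := eqVneq s 0; first by rewrite add0r ge_min lexx orbT.
have [->|t0] := eqVneq t 0; first by rewrite addr0 ge_min lexx.
have [->|st0] := eqVneq (s + t) 0; first by rewrite padic_val0 leey.
pose d := denq s * denq t; pose m := numq s * denq t; pose n := numq t * denq s.
have d0 : d != 0 by rewrite mulf_neq0 ?denq_neq0.
have es : s = m%:~R / d%:~R.
  by rewrite -[LHS]divq_num_den !intrM; field; rewrite !intr_eq0 !denq_neq0.
have et : t = n%:~R / d%:~R.
  by rewrite -[LHS]divq_num_den !intrM; field; rewrite !intr_eq0 !denq_neq0.
have m0 : m != 0 by rewrite mulf_neq0 ?numq_eq0 ?denq_neq0.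
have n0 : n != 0 by rewrite mulf_neq0 ?numq_eq0 ?denq_neq0.
have est : s + t = (m + n)%:~R / d%:~R by rewrite es et -mulrDl -intrD.
have mn0 : m + n != 0.
  by apply: contraNneq st0; rewrite est => ->; rewrite mul0r.
rewrite est es et !padic_val_div// ge_min !lee_fin !lerD2r !lez_nat -geq_min.
rewrite -pfactor_dvdn ?absz_gt0// -[X in (X %| _)%N]absz_nat -dvdzE.
apply: rpredD; rewrite dvdzE pfactor_dvdn ?absz_gt0//.
  exact: geq_minl.
exact: geq_minr.
Qed.

(** The upper bound comes from the ultrametric inequality for [s = (s + t) - t], where [t] cannot
    attain the minimum. *)
Lemma padic_valD_lt (p : nat) (s t : rat) : prime p ->
  (padic_val p s < padic_val p t)%E -> padic_val p (s + t) = padic_val p s.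
Proof.
move=> pp st; apply/eqP; rewrite eq_le; apply/andP; split.
  have := @padic_valD_ge p (s + t) (- t) pp.
  by rewrite addrK padic_valN ge_min (leNgt (padic_val p t)) st orbF.
by have := padic_valD_ge p s t pp; rewrite (min_idPl (ltW st)).
Qed.

Lemma padic_val_sub_unit (p : nat) (s t : rat) : prime p ->
  (0 <= padic_val p s)%E -> (0 <= padic_val p t)%E ->
  padic_val p (s - t) = 0%E -> padic_val p s = 0%E \/ padic_val p t = 0%E.
Proof.
move=> pp s0 t0 st; have := padic_valD_ge p s (- t) pp.
rewrite st padic_valN ge_min => /orP[] h; [left|right];
  by apply/eqP; rewrite eq_le h.
Qed.

(** Numerator and denominator contain the same power of [p]; being coprime, they contain none. *)
Lemma padic_val_unit_ndvd (p : nat) (t : rat) : prime p ->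
  padic_val p t = 0%E -> ~~ (p %| `|numq t|)%N /\ ~~ (p %| `|denq t|)%N.
Proof.
move=> pp; rewrite /padic_val; case: eqVneq => // t0 [] /eqP.
rewrite subr_eq0 => /eqP [] e.
have n0 : (0 < `|numq t|)%N by rewrite absz_gt0 numq_eq0.
have d0 : (0 < `|denq t|)%N by rewrite absz_gt0 denq_neq0.
have key : (p %| `|numq t|)%N = (p %| `|denq t|)%N.
  by rewrite -[p]expn1 !pfactor_dvdn// e.
suff : ~~ (p %| `|numq t|)%N by split; rewrite -?key.
apply/negP => h; have : (p %| gcdn `|numq t| `|denq t|)%N by rewrite dvdn_gcd h -key.
by rewrite (eqP (coprime_num_den t)) dvdn1 => /eqP p1; rewrite p1 in pp.
Qed.

(** This is [(m / n)^2 + 1 = (k / d)^2] with denominators cleared. Modulo 3 it becomes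
    [2 d^2 = k^2], which forces 3 to divide both [k] and [d]. *)
Lemma sum_squares_mod3 (m n k d : nat) : coprime k d ->
  ~~ (3 %| m)%N -> ~~ (3 %| n)%N -> ((m ^ 2 + n ^ 2) * d ^ 2 <> (k * n) ^ 2)%N.
Proof.
move=> kd m3 n3 e.
have sq1 i : ~~ (3 %| i)%N -> (i ^ 2 = 1 %[mod 3])%N.
  by rewrite /dvdn -modnXm; have := ltn_pmod i (isT : (0 < 3)%N);
     case: (i %% 3)%N => [|[|[|]]].
have {e} : ((m ^ 2 + n ^ 2) * d ^ 2 = (k * n) ^ 2 %[mod 3])%N by rewrite e.
rewrite expnMn -modnMml -modnDm !sq1// modnMml -[in RHS]modnMmr sq1// modnMmr.
have [d3|/sq1 ed] := boolP (3 %| d)%N.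
  have [k3|/sq1 ek] := boolP (3 %| k)%N.
    by have := dvdn_gcd 3 k d; rewrite (eqP kd) d3 k3.
  rewrite muln1 ek -modnMmr; have /eqP -> : (3 %| d ^ 2)%N by rewrite dvdn_exp.
  by [].
have [k3|/sq1 ek] := boolP (3 %| k)%N.
  rewrite muln1 -modnMmr ed.
  by have /eqP -> : (3 %| k ^ 2)%N by rewrite dvdn_exp.
by rewrite -modnMmr ed muln1 ek.
Qed.

Lemma sum_squares_padic3 (u w r : rat) :
  padic_val 3 u = padic_val 3 w -> w != 0 -> u ^+ 2 + w ^+ 2 <> r ^+ 2.
Proof.
move=> uw w0 e; pose t := u / w; pose s := r / w.
have et : t ^+ 2 + 1 = s ^+ 2.
  by rewrite /t /s !expr_div_n -e mulrDl divff// expf_neq0.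
have vt : padic_val 3 t = 0%E.
  have := padic_valM 3 t w isT; rewrite divfK// uw.
  rewrite [padic_val 3 w]/padic_val (negbTE w0).
  (* The valuation of [w] is finite because [w] is nonzero, so it cancels. *)
  case: (padic_val 3 t) => // c [] /eqP.
  by rewrite -subr_eq subrr => /eqP <-.
have [nt dt] := @padic_val_unit_ndvd 3 t isT vt.
apply: (@sum_squares_mod3 _ _ `|numq s| `|denq s| (coprime_num_den s) nt dt).
(* The identity is proved over the integers; absolute values then bring it to the naturals, since
   the squares are nonnegative. *)
suff : (numq t ^+ 2 + denq t ^+ 2) * denq s ^+ 2 = (numq s * denq t) ^+ 2.
  move/(congr1 absz); rewrite ![_ ^+ 2]expr2 !abszM -!mulnn => <-.
  congr (_ * _)%N; rewrite -!abszM -!expr2.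
  by have := sqr_ge0 (numq t); have := sqr_ge0 (denq t); lia.
apply: (@intr_inj rat); rewrite !(intrM, intrD) !numqE.
transitivity ((t ^+ 2 + 1) * ((denq t)%:~R * (denq s)%:~R) ^+ 2); first by ring.
by rewrite et; ring.
Qed.

Lemma eucl_dist_sqr {R : realType} (P Q : R * R) :
  eucl_dist P Q ^+ 2 = (P.1 - Q.1) ^+ 2 + (P.2 - Q.2) ^+ 2.
Proof. by rewrite /eucl_dist sqr_sqrtr ?addr_ge0 ?sqr_ge0. Qed.

Lemma rational_dist_sum_squares {R : realType} (x z x' z' : rat) :
  rational (@eucl_dist R (ratr x, ratr z / 2) (ratr x', ratr z' / 2)) ->
  exists r : rat, (2 * x - 2 * x') ^+ 2 + (z - z') ^+ 2 = r ^+ 2.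
Proof.
move=> [r _ er]; exists (2 * r); apply: (@fmorph_inj _ R ratr).
rewrite exprMn rmorphM !rmorphXn /= er eucl_dist_sqr /=.
rewrite !(rmorphD, rmorphB, rmorphN, rmorphM, rmorphXn) /= rmorph1.
by field.
Qed.

Theorem theorem2p3 (R : realType) (a : rat) (ha : padic_val 3 a = 0%E)
    (x z : R)
    (hdist : forall P : R * R, rect_points a P ->
       rational (eucl_dist (x, z / 2) P)) :
  exists qx qz : rat,
    [/\ x = ratr qx, z = ratr qz,
        (padic_val 3 qx < 0)%E \/ (padic_val 3 qz < 0)%E
      & padic_val 3 qx <> padic_val 3 qz].
Proof.
have a0 : a != 0 by apply: contra_eq_neq ha => ->; rewrite padic_val0.
have d1 : rational (eucl_dist (x, z / 2) (0, 1 / 2)).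
  by apply: hdist; constructor 1.
have d2 : rational (eucl_dist (x, z / 2) (0, - (1 / 2))).
  by apply: hdist; constructor 2.
have d3 : rational (eucl_dist (x, z / 2) (ratr a, 1 / 2)).
  by apply: hdist; constructor 3.
have d4 : rational (eucl_dist (x, z / 2) (ratr a, - (1 / 2))).
  by apply: hdist; constructor 4.
(* [(z / 2 + 1 / 2)^2 - (z / 2 - 1 / 2)^2 = z]. *)
have [qz ez] : exists qz : rat, z = ratr qz.
  have [[r1 _ e1] [r2 _ e2]] := (d1, d2); exists (r2 ^+ 2 - r1 ^+ 2).
  by rewrite rmorphB !rmorphXn /= e1 e2 !eucl_dist_sqr /=; field.
(* [x^2 - (x - a)^2 = 2 a x - a^2], solved for [x] using [a != 0]. *)
have [qx ex] : exists qx : rat, x = ratr qx.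
  have [[r1 _ e1] [r3 _ e3]] := (d1, d3).
  exists ((r1 ^+ 2 - r3 ^+ 2 + a ^+ 2) / (2 * a)).
  rewrite fmorph_div rmorphM rmorphD rmorphB !rmorphXn /= e1 e3 !eucl_dist_sqr /= ratr_nat.
  by field; rewrite fmorph_eq0.
exists qx, qz.
have sum_sq (b c : rat) : (b == 0) || (b == a) -> (c == 1) || (c == -1) ->
    exists r : rat, (2 * qx - 2 * b) ^+ 2 + (qz - c) ^+ 2 = r ^+ 2.
  move=> hb hc; apply: (@rational_dist_sum_squares R); rewrite -ex -ez.
  by case/orP: hb => /eqP ->; case/orP: hc => /eqP ->;
    rewrite ?rmorph0 ?rmorphN ?rmorph1 ?mulNr.
have v2 (t : rat) : padic_val 3 (2 * t) = padic_val 3 t.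
  by rewrite padic_valM// (_ : padic_val 3 2 = 0%E)// add0e.
have neg : (padic_val 3 qx < 0)%E \/ (padic_val 3 qz < 0)%E.
  case: (ltP (padic_val 3 qx) 0%E) => [|x0]; first by left.
  case: (ltP (padic_val 3 qz) 0%E) => [|z0]; first by right.
  have int_sub (s t : rat) : (0 <= padic_val 3 s)%E -> padic_val 3 t = 0%E ->
      (0 <= padic_val 3 (s - t)%R)%E.
    move=> s0 t0; apply: le_trans (padic_valD_ge 3 s (- t) isT).
    by rewrite padic_valN t0 le_min s0 lexx.
  (* The choices of [b] here and of [c] below are independent; together they select the corner
     [(b, c / 2)] at which both offsets are units. *)
  have [b hb vb] : exists2 b : rat, (b == 0) || (b == a) &
      padic_val 3 (2 * qx - 2 * b) = 0%E.
    have [|||v|v] := @padic_val_sub_unit 3 (2 * qx - 2 * 0) (2 * qx - 2 * a) isT.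
    - by rewrite mulr0 subr0 v2.
    - by rewrite int_sub ?v2.
    - by rewrite (_ : _ - _ = 2 * a) ?v2//; ring.
    - by exists 0; rewrite ?eqxx.
    - by exists a; rewrite ?eqxx ?orbT.
  have [c hc vc] : exists2 c : rat, (c == 1) || (c == -1) &
      padic_val 3 (qz - c) = 0%E.
    have [|||v|v] := @padic_val_sub_unit 3 (qz - (-1)) (qz - 1) isT.
    - by rewrite int_sub.
    - by rewrite int_sub.
    - by rewrite (_ : _ - _ = 2)//; ring.
    - by exists (-1); rewrite ?eqxx ?orbT.
    - by exists 1; rewrite ?eqxx.
  have [r] := sum_sq b c hb hc.
  case/sum_squares_padic3; first by rewrite vb vc.
  by apply: contra_eq_neq vc => ->; rewrite padic_val0.
split=> // exz.
have z0 : (padic_val 3 qz < 0)%E by case: neg; rewrite ?exz.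
(* The term [-1] has valuation 0, strictly above that of [qz]. The corner [(0, 1 / 2)] then gives
   the contradiction. *)
have vz : padic_val 3 (qz - 1) = padic_val 3 qz.
  by rewrite padic_valD_lt.
have [r] := sum_sq 0 1 isT isT; rewrite mulr0 subr0.
case/sum_squares_padic3; first by rewrite v2 vz.
by apply: contraTneq z0 => z1; rewrite -vz z1 padic_val0.
Qed.
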